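(* $\displaystyle\lim_{n \to \infty} \frac{\delta_n(C,\mathfrak{C})}{n} = \frac{1}{2}$, where $\delta_n(C,\mathfrak{C})=\max\{d_T(C,\mathfrak{C}) : T \text{ is a tree on } n \text{ vertices}\}$.
   Context: For a tree $T$ and $u,v\in V(T)$, $d_T(u,v)$ is the number of edges of the $u$-$v$ path; for $X,Y\subseteq V(T)$, $d(X,Y)=\min\{d_T(x,y): x\in X, y\in Y\}$. The center $C(T)$ is the set of vertices $v$ minimizing the eccentricity $e(v)=\max\{d_T(v,u): u\in V(T)\}$. For $u,v\in V(T)$, $f_T(v,u)$ is the number of subtrees (connected subgraphs) of $T$ containing both $v$ and $u$. The eccentric subtree number of $v$ is $\epsilon_T(v)=\min\{f_T(v,u):u\in V(T)\}$, and the core center $\mathfrak{C}(T)$ is the set of vertices maximizing $\epsilon_T$. Write $d_T(C,\mathfrak{C})=d(C(T),\mathfrak{C}(T))$. *)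

(* Defs.v *)
From mathcomp Require Import all_boot boolp.
(* Not imported: it would shadow finset notations. *)
From mathcomp Require classical_sets.

Set Implicit Arguments.
Unset Strict Implicit.
Unset Printing Implicit Defensive.

Local Open Scope nat_scope.

(* A graph on the vertex type [V] is given by its set of edges, an edge being
   a two-element set of vertices. *)

Definition simple_graph (V : finType) (E : {set {set V}}) : bool :=
  [forall A in E, #|A| == 2].

Definition adj (V : finType) (E : {set {set V}}) : rel V :=
  [rel x y | [set x; y] \in E].

(* Every edge of [F] is meant to be a subset of [W]. *)
Definition connected_graph (V : finType) (W : {set V}) (F : {set {set V}}) :
    bool :=
  (W != set0) && [forall x in W, forall y in W, connect (adj F) x y].

Definition acyclic_graph (V : finType) (E : {set {set V}}) : Prop :=
  forall s : seq V, 2 < size s -> ~ ucycle (adj E) s.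

Definition is_tree (V : finType) (E : {set {set V}}) : Prop :=
  [/\ simple_graph E, connected_graph [set: V] E & acyclic_graph E].

(* The u-v path of a tree, without its first vertex u, so that its size is the
   number of edges; outside of trees the choice is irrelevant. *)
Definition tree_path (V : finType) (E : {set {set V}}) (u v : V) : seq V :=
  classical_sets.xget [::] (fun p : seq V =>
    [/\ path (adj E) u p, uniq (u :: p) & last u p = v]).

Definition tree_dist (V : finType) (E : {set {set V}}) (u v : V) : nat :=
  size (tree_path E u v).

(* The default value [#|V|] exceeds all distances, hence plays no role when
   [X] and [Y] are nonempty. *)
Definition set_dist (V : finType) (E : {set {set V}}) (X Y : {set V}) : nat :=
  \big[minn/#|V|]_(x in X) \big[minn/#|V|]_(y in Y) tree_dist E x y.

Definition eccentricity (V : finType) (E : {set {set V}}) (v : V) : nat :=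
  \max_(u : V) tree_dist E v u.

Definition center (V : finType) (E : {set {set V}}) : {set V} :=
  [set v | [forall u, eccentricity E v <= eccentricity E u]].

(* [S.1] is the set of vertices and [S.2] the set of edges of a subgraph. *)
Definition is_subtree (V : finType) (E : {set {set V}})
    (S : {set V} * {set {set V}}) : bool :=
  [&& S.2 \subset E, [forall A in S.2, A \subset S.1]
    & connected_graph S.1 S.2].

Definition num_subtrees (V : finType) (E : {set {set V}}) (v u : V) : nat :=
  #|[set S : {set V} * {set {set V}} |
      [&& is_subtree E S, v \in S.1 & u \in S.1]]|.

(* The default value is the term of index [u = v], so this is the minimum. *)
Definition ecc_subtree_num (V : finType) (E : {set {set V}}) (v : V) : nat :=
  \big[minn/num_subtrees E v v]_(u : V) num_subtrees E v u.

Definition core_center (V : finType) (E : {set {set V}}) : {set V} :=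
  [set v | [forall u, ecc_subtree_num E u <= ecc_subtree_num E v]].

Definition center_core_dist (V : finType) (E : {set {set V}}) : nat :=
  set_dist E (center E) (core_center E).

(* There is no tree for [n = 0], and the maximum is then 0. *)
Definition max_center_core_dist (n : nat) : nat :=
  \max_(E : {set {set 'I_n}} | `[< is_tree E >]) center_core_dist E.

(* Main.v *)
Require Import Defs.
From mathcomp Require Import all_boot all_order all_algebra zify lra.
From mathcomp Require Import all_classical all_reals all_analysis.
Import Order.TTheory GRing.Theory Num.Theory.
Import numFieldNormedType.Exports.

Set Implicit Arguments.
Unset Strict Implicit.
Unset Printing Implicit Defensive.

Local Open Scope nat_scope.

(** Two matching estimates give the limit.

    Upper bound. Any vertex is within the radius r of a center vertex c, so the
    distance between the two centers is at most r, and it suffices that a tree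
    of radius r has at least 2r vertices ([radius_bound]). Let c' be the
    neighbour of c towards a vertex at distance r. As c has minimal
    eccentricity, some w is at distance at least r from c'; the path from c' to
    w has to start with the edge c'c, since otherwise w would be at distance
    more than r from c. The two sides of the edge cc' then each contain a path
    with r vertices.

    Lower bound. Take a comet: a path p_0, ..., p_L (the spine), with m leaves
    attached to p_0. Its diameter is L + 1, so its center lies near p_(L/2). Its
    core center is near the other end p_L as soon as 2^(m-1) exceeds the number
    of vertices. Indeed, the eccentric subtree number of a vertex v is at most
    the number of subtrees through v and p_L. A subtree through p_L either
    contains the whole spine, and is given by its set of leaves, or it is a
    final segment of the spine; hence there are at most 2^m + n of these
    ([comet_subtree_le]). On the other hand, w = p_(L-2) and a leaf lie in at
    least 3 * 2^(m-1) common subtrees, since such a subtree may end at p_(L-2),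
    p_(L-1) or p_L and contain any of the m - 1 other leaves
    ([comet_subtree_ge]). For a vertex u at or beyond w the subtrees containing
    w and u include strictly those through v and p_L whenever v comes before w
    ([comet_subtree_mono]). So the eccentric subtree number of every v before w
    is smaller than that of w, and the distance of the two centers is at least
    L/2 - O(1). Finally m = n/k, with k fixed and n large, makes 2^(m-1) exceed
    n while it costs only a fraction 1/k of the vertices. *)

(** * Minima over finite types *)

Lemma bigminn_le (I : finType) (P : pred I) (F : I -> nat) (d : nat) (i : I) :
  P i -> \big[minn/d]_(j | P j) F j <= F i.
Proof.
move=> Pi; have: i \in index_enum I by rewrite mem_index_enum.
elim: (index_enum I) => // j s IHs; rewrite inE big_cons => /predU1P[<-|/IHs le_s].
  by rewrite Pi geq_minl.
by case: (P j) => //; rewrite geq_min le_s orbT.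
Qed.

Lemma le_bigminn (I : finType) (P : pred I) (F : I -> nat) (d k : nat) :
  k <= d -> (forall i, P i -> k <= F i) -> k <= \big[minn/d]_(i | P i) F i.
Proof.
move=> le_kd le_kF; elim/big_ind: _ => // x y; rewrite leq_min => -> //.
Qed.

(** * Paths in trees *)

Lemma adj_sym (V : finType) (E : {set {set V}}) : symmetric (adj E).
Proof. by move=> x y; rewrite /adj /= finset.setUC. Qed.

(** After their common prefix, two different paths leave a vertex u through
    different neighbours x and y. Both tails avoid u, so x and y are still
    connected when u is removed, and a simple path between them in this smaller
    graph closes up to a cycle through u. *)
Lemma acyclic_path_unique (V : finType) (E : {set {set V}}) (u : V) (p q : seq V) :
  acyclic_graph E -> path (adj E) u p -> uniq (u :: p) ->
  path (adj E) u q -> uniq (u :: q) -> last u p = last u q -> p = q.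
Proof.
move=> acyE; elim: p q u => [|x p IHp] [|y q] u //.
- move=> _ _ _ /= /andP[/negP u_notin _] def_u.
  by case: u_notin; rewrite {1}def_u mem_last.
- move=> _ /= /andP[/negP u_notin _] _ _ def_u.
  by case: u_notin; rewrite -{1}def_u mem_last.
move=> /= /andP[ux xp] /andP[u_xp xp_uniq] /andP[uy yq] /andP[u_yq yq_uniq] eq_last.
have [eq_xy | neq_xy] := eqVneq x y.
  by subst y; rewrite (IHp q x).
(* adjacency in the graph without u *)
pose e := [rel a b | [&& adj E a b, a != u & b != u]].
have e_sym : symmetric e.
  by move=> a b; rewrite /e /= adj_sym [(b != u) && _]andbC.
have avoid z s : path (adj E) z s -> u \notin z :: s -> connect e z (last z s).
  move=> zs u_zs; apply/connectP; exists s => //.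
  apply: (@sub_in_path _ [pred a | a != u] (adj E)) zs.
    by move=> a b; rewrite !inE /e /= => -> -> ->.
  by apply/allP => a a_zs; rewrite inE; apply: contraNneq u_zs => <-.
have: connect e x y.
  apply: (connect_trans (avoid x p xp u_xp)).
  by rewrite (sym_connect_sym e_sym) eq_last avoid.
case/connectP=> s0 e_s0 def_y.
case: (shortenP e_s0) def_y => s e_s s_uniq _ def_y.
case: s e_s s_uniq def_y => [|z s] e_s s_uniq def_y.
  by rewrite /= in def_y; rewrite def_y eqxx in neq_xy.
have sub_e : subrel e (adj E) by move=> a b /and3P[].
case: (acyE [:: u, x, z & s]) => //; apply/andP; split.
  rewrite /cycle rcons_path -[path _ _ _]/(adj E u x && path (adj E) x (z :: s)).
  rewrite ux (sub_path sub_e e_s : path (adj E) x (z :: s)) /=.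
  by rewrite -[last z s]/(last x (z :: s)) -def_y adj_sym.
rewrite cons_uniq s_uniq andbT.
rewrite inE negb_or; apply/andP; split.
  by apply: contraNneq u_xp => ->; rewrite inE eqxx.
apply/negP => u_s; have := e_s.
elim: (z :: s) (x) u_s => // b s' IHs a; rewrite inE => /predU1P[<-|u_s'] /=.
  by rewrite eqxx !andbF.
by case/andP=> _; apply: IHs.
Qed.

(** The choice made by [tree_path] is among a nonempty set in a tree. *)
Lemma tree_pathP (V : finType) (E : {set {set V}}) (u v : V) :
  is_tree E ->
  [/\ path (adj E) u (tree_path E u v), uniq (u :: tree_path E u v)
    & last u (tree_path E u v) = v].
Proof.
case=> _ /andP[_ /forall_inP con] _.
have /forall_inP/(_ v (finset.in_setT _))/connectP[p up ->] := con u (finset.in_setT _).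
case/shortenP: up => q uq q_uniq _.
by apply: (@xgetPex _ [::] [set r | [/\ path (adj E) u r, uniq (u :: r)
  & last u r = last u q]]%classic); exists q.
Qed.

Lemma tree_path_unique (V : finType) (E : {set {set V}}) (u v : V) (p : seq V) :
  is_tree E -> path (adj E) u p -> uniq (u :: p) -> last u p = v ->
  tree_path E u v = p.
Proof.
move=> treeE up p_uniq up_v; have [uq q_uniq uq_v] := tree_pathP u v treeE.
case: treeE => _ _ acyE.
by apply: (acyclic_path_unique (u := u) acyE) => //; rewrite uq_v up_v.
Qed.

(** In a tree, removing the loops of a walk leaves the only path with the same
    ends. *)
Lemma tree_dist_path (V : finType) (E : {set {set V}}) (u : V) (p : seq V) :
  is_tree E -> path (adj E) u p -> tree_dist E u (last u p) <= size p.
Proof.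
move=> treeE up; case/shortenP: (up) => q uq q_uniq sub_qp.
rewrite /tree_dist (tree_path_unique treeE uq q_uniq erefl).
by apply: uniq_leq_size => //; case/andP: q_uniq.
Qed.

(** * Trees have at least twice as many vertices as their radius *)

Lemma tree_dist_le_ecc (V : finType) (E : {set {set V}}) (u v : V) :
  tree_dist E u v <= eccentricity E u.
Proof. exact: (leq_bigmax v). Qed.

Lemma set_dist_le (V : finType) (E : {set {set V}}) (X Y : {set V}) (x y : V) :
  x \in X -> y \in Y -> set_dist E X Y <= tree_dist E x y.
Proof.
move=> xX yY; apply: leq_trans (bigminn_le _ _ xX) _.
exact: bigminn_le yY.
Qed.

Lemma centerP (V : finType) (E : {set {set V}}) (c : V) :
  reflect (forall u, eccentricity E c <= eccentricity E u) (c \in Defs.center E).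
Proof. by rewrite inE; apply: forallP. Qed.

Lemma center_nonempty (V : finType) (E : {set {set V}}) (x : V) :
  exists c, c \in Defs.center E.
Proof.
exists [arg min_(c < x) eccentricity E c]; apply/centerP => u.
by case: arg_minnP => // c _; apply.
Qed.

Lemma core_center_nonempty (V : finType) (E : {set {set V}}) (x : V) :
  exists c, c \in core_center E.
Proof.
exists [arg max_(c > x) ecc_subtree_num E c]; rewrite inE; apply/forallP => u.
by case: arg_maxnP => // c _; apply.
Qed.

(** Here u is farthest from c, c' is the neighbour of c on the way to u, and w is
    farthest from c'. The c'-w path is shown to start with the edge c'c; what
    follows c' on it and what follows c on the c-u path are then disjoint,
    because a common vertex would be reached from c both through c' and while
    avoiding c'. *)
Lemma radius_bound (V : finType) (E : {set {set V}}) (c : V) :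
  is_tree E -> c \in Defs.center E -> 2 * eccentricity E c <= #|V|.
Proof.
move=> treeE /centerP c_min.
have V_gt0 : 0 < #|V| by apply/card_gt0P; exists c.
have [u def_r] : exists u, eccentricity E c = tree_dist E c u.
  by have [u def] := bigop.eq_bigmax (tree_dist E c) V_gt0; exists u;
    rewrite /eccentricity -def.
have [up p_uniq up_v] := tree_pathP c u treeE; move: def_r up p_uniq up_v.
rewrite /tree_dist; case: (tree_path E c u) => [-> //|c' p] def_r.
rewrite def_r /= => /andP[cc' c'p] /andP[c_p p_uniq] _.
have [w def_r'] : exists w, eccentricity E c' = tree_dist E c' w.
  by have [w def] := bigop.eq_bigmax (tree_dist E c') V_gt0; exists w;
    rewrite /eccentricity -def.
have := c_min c'; rewrite def_r' def_r /=.
have [uq q_uniq uq_w] := tree_pathP c' w treeE; move: uq q_uniq uq_w.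
have c_far := tree_dist_le_ecc E c w.
rewrite /tree_dist; case: (tree_path E c' w) => // a q /=.
move=> /andP[c'a aq] /andP[c'_q q_uniq] q_w le_r.
have [eq_ac|neq_ac] := eqVneq a c; last first.
  have [c_aq|c_aq] := boolP (c \in a :: q).
    (* c' reaches c both by an edge and through a *)
    case/splitPl: c_aq aq c'_q q_uniq q_w le_r => q1 q2 def_c.
    rewrite cat_path => /andP[aq1 _] c'_q q_uniq _ _.
    have eq1: a :: q1 = [:: c].
      case: treeE => _ _ acyE.
      apply: (acyclic_path_unique (u := c') acyE) => //=.
      - by rewrite c'a.
      - move: c'_q q_uniq; rewrite -cat_cons mem_cat negb_or => /andP[-> _].
        move=> /andP[]; rewrite mem_cat negb_or => /andP[-> _].
        by rewrite cat_uniq => /andP[-> _].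
      - by rewrite adj_sym cc'.
      - by rewrite inE andbT eq_sym; move: c_p; rewrite inE negb_or => /andP[].
    by case: eq1 neq_ac => ->; rewrite eqxx.
  (* the path through c' from c to w would be longer than the radius *)
  have := tree_path_unique (p := [:: c', a & q]) treeE _ _ q_w.
  move=> /(_ c); rewrite /= cc' c'a aq c'_q q_uniq !andbT.
  rewrite inE negb_or c_aq andbT => /(_ isT).
  move: c_p; rewrite inE negb_or => /andP[-> _] => /(_ isT) tp.
  by move: c_far; rewrite /tree_dist tp def_r => /leq_trans/(_ le_r); rewrite ltnn.
subst a; have dis : uniq ((c' :: p) ++ (c :: q)).
  rewrite cat_uniq (p_uniq : uniq (c' :: p)) (q_uniq : uniq (c :: q)) andbT.
  apply/hasPn => z z_q; apply/negP => z_p.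
  case/splitPl: z_p c'p c_p p_uniq => p1 p2 def_z.
  rewrite cat_path => /andP[c'p1 _] c_p p_uniq.
  case/splitPl: z_q aq c'_q q_uniq q_w {le_r} => q1 q2 def_z'.
  rewrite cat_path => /andP[cq1 _] c'_q q_uniq _.
  have eq1: c' :: p1 = q1.
    case: treeE => _ _ acyE.
    apply: (acyclic_path_unique (u := c) acyE) => //=.
    - by rewrite cc'.
    - move: c_p p_uniq; rewrite -cat_cons mem_cat negb_or => /andP[-> _].
      by rewrite mem_cat negb_or => /andP[/andP[-> _]]; rewrite cat_uniq => /andP[-> _].
    - by move: q_uniq; rewrite mem_cat negb_or cat_uniq => /andP[/andP[-> _] /andP[-> _]].
    - by rewrite def_z def_z'.
  by move: c'_q; rewrite -eq1 !inE eqxx orbT.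
move/card_uniqP: dis; rewrite size_cat /= => dis.
apply: leq_trans (max_card (mem ((c' :: p) ++ c :: q))).
by rewrite dis mul2n -addnn leq_add2l.
Qed.

Lemma max_center_core_dist_le (n : nat) : 2 * max_center_core_dist n <= n.
Proof.
suff: max_center_core_dist n <= n./2 by lia.
apply/bigmax_leqP => E /asboolP treeE.
have [x _] : exists x : 'I_n, x \in [set: 'I_n].
  by case: treeE => _ /andP[/finset.set0Pn].
have [c c_cen] := center_nonempty E x; have [v v_core] := core_center_nonempty E x.
apply: leq_trans (set_dist_le E c_cen v_core) _.
apply: leq_trans (tree_dist_le_ecc E c v) _.
by have := radius_bound treeE c_cen; rewrite card_ord; lia.
Qed.

(** * Induced subtrees and heights *)

(** Following a parent relation that decreases [rk] inside W leads every vertex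
    of W to the root a. *)
Lemma rooted_connected (V : finType) (W : {set V}) (F : {set {set V}}) (a : V)
    (rk : V -> nat) :
  a \in W ->
  (forall x, x \in W -> x != a -> exists y, [/\ y \in W, adj F x y & rk y < rk x]) ->
  connected_graph W F.
Proof.
move=> aW down; apply/andP; split; first by apply/finset.set0Pn; exists a.
have to_a x : x \in W -> connect (adj F) x a.
  have [k] := ubnP (rk x); elim: k x => // k IHk x lt_xk xW.
  have [->|neq_xa] := eqVneq x a; first exact: connect0.
  have [y [yW xy lt_yx]] := down x xW neq_xa.
  by apply: connect_trans (connect1 xy) (IHk y _ yW); lia.
apply/forall_inP => x xW; apply/forall_inP => y yW.
apply: connect_trans (to_a x xW) _.
by rewrite (sym_connect_sym (@adj_sym V F)) to_a.
Qed.

Definition induced_edges (V : finType) (E : {set {set V}}) (W : {set V}) :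
    {set {set V}} :=
  [set A in E | A \subset W].

Lemma adj_induced (V : finType) (E : {set {set V}}) (W : {set V}) (x y : V) :
  adj (induced_edges E W) x y = [&& adj E x y, x \in W & y \in W].
Proof. by rewrite /adj /= inE finset.subUset !finset.sub1set. Qed.

Lemma induced_subtree (V : finType) (E : {set {set V}}) (W : {set V}) :
  connected_graph W (induced_edges E W) -> is_subtree E (W, induced_edges E W).
Proof.
move=> con; apply/and3P; split=> //=.
  by apply/fintype.subsetP => A; rewrite inE => /andP[].
by apply/forall_inP => A; rewrite inE => /andP[].
Qed.

(** Subtrees of a tree may thus be counted by their sets of vertices: an edge
    between two vertices of a subtree S is the only path between them, hence the
    one that S contains. *)
Lemma subtree_edges (V : finType) (E : {set {set V}})
    (S : {set V} * {set {set V}}) :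
  is_tree E -> is_subtree E S -> S.2 = induced_edges E S.1.
Proof.
move=> [/forall_inP simE _ acyE] /and3P[sub_E /forall_inP sub_S /andP[_ /forall_inP con]].
apply/setP => A; rewrite inE; apply/idP/andP => [AS|[AE AS]].
  by rewrite (fintype.subsetP sub_E) // sub_S.
have /cards2P[x [y [neq_xy def_A]]] := simE A AE; subst A.
move: AS; rewrite finset.subUset !finset.sub1set => /andP[xS yS].
have /forall_inP/(_ y yS)/connectP[p0 xp0 def_y] := con x xS.
case: (shortenP xp0) def_y => p xp p_uniq _ def_y.
have sub_adj : subrel (adj S.2) (adj E).
  by move=> a b; rewrite /adj /= => /(fintype.subsetP sub_E).
have def_p: p = [:: y].
  apply: (acyclic_path_unique (u := x) acyE) => //=.
  - exact: sub_path xp.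
  - by rewrite andbT.
  - by rewrite inE neq_xy.
by move: xp; rewrite def_p /= andbT.
Qed.

(** A discrete intermediate value theorem, applied along a path inside S. When
    the values of h identify vertices, it says which vertices a subtree must
    contain. *)
Lemma subtree_height_ivt (V : finType) (E : {set {set V}}) (h : V -> nat)
    (S : {set V} * {set {set V}}) (x y : V) (k : nat) :
  (forall a b, adj E a b -> h b <= (h a).+1) ->
  is_subtree E S -> x \in S.1 -> y \in S.1 -> h x <= k <= h y ->
  exists2 z, z \in S.1 & h z = k.
Proof.
move=> lip /and3P[sub_E /forall_inP sub_S /andP[_ /forall_inP con]] xS yS.
have /forall_inP/(_ y yS)/connectP[p xp ->] := con x xS.
elim: p x xS xp => [|z p IHp] x xS /=; first by exists x => //; lia.
case/andP=> xz zp; have [<- _|neq] := eqVneq (h x) k; first by exists x.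
have zS : z \in S.1.
  by have := sub_S _ xz; rewrite finset.subUset !finset.sub1set => /andP[].
have := lip x z (fintype.subsetP sub_E _ xz) => le_zx bnd.
by apply: (IHp z) => //; lia.
Qed.

Lemma height_le_dist (V : finType) (E : {set {set V}}) (h : V -> nat) (x y : V) :
  (forall a b, adj E a b -> h b <= (h a).+1) -> is_tree E ->
  h y <= h x + tree_dist E x y.
Proof.
move=> lip treeE; rewrite /tree_dist; have [xp _ last_y] := tree_pathP x y treeE.
rewrite -{1}last_y; move: (tree_path E x y) xp {last_y} => p; elim: p x => [|z p IHp] x /=.
  by rewrite addn0.
by case/andP=> /lip le_zx /IHp; lia.
Qed.

(** * Trees given by a parent function *)

Definition parent_edges (n : nat) (par : nat -> nat) : {set {set 'I_n}} :=
  [set A | [exists x : 'I_n, exists y : 'I_n,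
     [&& 0 < x, y == par x :> nat & A == [set x; y]]]].

Lemma set2_inj (T : finType) (x y a b : T) :
  [set x; y] = [set a; b] -> x = a /\ y = b \/ x = b /\ y = a.
Proof.
move=> eq_set.
have: x \in [set a; b] by rewrite -eq_set finset.set21.
have: y \in [set a; b] by rewrite -eq_set finset.set22.
have: a \in [set x; y] by rewrite eq_set finset.set21.
have: b \in [set x; y] by rewrite eq_set finset.set22.
by do 4!case/finset.set2P => ?; subst; auto.
Qed.

Lemma adj_parent (n : nat) (par : nat -> nat) (x y : 'I_n) :
  adj (parent_edges n par) x y =
  (0 < x) && (y == par x :> nat) || (0 < y) && (x == par y :> nat).
Proof.
rewrite /adj /= inE; apply/existsP/orP.
  case=> a /existsP[b /and3P[a_gt0 /eqP def_b /eqP eq_xy]].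
  by case: (set2_inj eq_xy) => -[-> ->]; [left | right]; apply/andP; split=> //; apply/eqP.
case=> /andP[gt0 def]; [exists x | exists y]; apply/existsP; [exists y | exists x].
  by apply/and3P.
by apply/and3P; split=> //; rewrite finset.setUC.
Qed.

(** A largest vertex of a cycle would have two different smaller neighbours, while
    its parent is the only one. *)
Lemma parent_tree (n : nat) (par : nat -> nat) :
  (forall x, 0 < x -> par x < x) -> is_tree (parent_edges n.+1 par).
Proof.
move=> par_lt; split.
- apply/forall_inP => A; rewrite inE.
  case/existsP=> x /existsP[y /and3P[x_gt0 /eqP def_y /eqP->]].
  rewrite cards2; suff -> : x != y by [].
  by apply/eqP => eq_xy; have := par_lt x x_gt0; rewrite -def_y eq_xy ltnn.
- apply: (@rooted_connected _ _ _ ord0 (@nat_of_ord _)) => [|x _ neq_x0].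
    exact: finset.in_setT.
  have x_gt0 : 0 < x by rewrite lt0n.
  have lt_y : par x < n.+1 by apply: ltn_trans (par_lt x x_gt0) _.
  exists (Ordinal lt_y); rewrite finset.in_setT adj_parent x_gt0 eqxx; split=> //.
  exact: par_lt.
move=> s s_gt2 /andP[s_cyc s_uniq].
have [a a_s] : exists a, a \in s.
  by case: s s_gt2 {s_cyc s_uniq} => // a s; exists a; rewrite inE eqxx.
have [x x_s x_max] : exists2 x, x \in s & forall y, y \in s -> y <= x.
  by exists [arg max_(x > a in s) x : nat]; case: arg_maxnP.
have [i s' def_s] := rot_to x_s.
have mem_s' y : y \in s' -> y \in s.
  by move=> ys'; rewrite -(mem_rot i) def_s inE ys' orbT.
move: s_cyc s_uniq s_gt2.
rewrite -(rot_cycle i) -(rot_uniq i) -(size_rot i) def_s {def_s}.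
have down y : y \in s' -> x \notin s' -> adj (parent_edges n.+1 par) x y ->
    y = par x :> nat.
  move=> ys' x_s'; rewrite adj_parent => /orP[/andP[_ /eqP //]|/andP[y_gt0 /eqP def_x]].
  have := x_max y (mem_s' y ys'); rewrite def_x leqNgt par_lt //.
case: s' {mem_s'} down => // y s' down /= /andP[xy]; rewrite rcons_path => /andP[_ zx].
move=> /andP[x_s' /andP[y_s' _]] s'_gt0.
have def_y := down y (mem_head _ _) x_s' xy.
have def_z: last y s' = par x :> nat by apply: down; rewrite ?mem_last // adj_sym.
case: s' y_s' s'_gt0 def_z {down x_s' zx} => // b s' /negP y_s' _ def_z; case: y_s'.
by rewrite (_ : y = last b s') ?mem_last //; apply: val_inj; rewrite /= def_y -def_z.
Qed.

(** * Comets *)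

(** The spine is 0, ..., L, and the vertices beyond L are leaves attached to 0. *)
Definition comet_parent (L x : nat) : nat := if x <= L then x.-1 else 0.

Definition comet (n L : nat) : {set {set 'I_n.+1}} :=
  parent_edges n.+1 (comet_parent L).

(** The position along the comet; the value 0 is shared by all leaves, and other
    values determine the vertex. *)
Definition height (n L : nat) (x : 'I_n.+1) : nat := if x <= L then x.+1 else 0.

Definition leaves (n L : nat) : {set 'I_n.+1} := [set x : 'I_n.+1 | height L x == 0].

Ltac height_lia := rewrite ?/height ?/comet_parent /=; repeat (case: ifP => ?); lia.

Lemma comet_tree (n L : nat) : is_tree (comet n L).
Proof. by apply: parent_tree => x; height_lia. Qed.

Lemma height_lip (n L : nat) (x y : 'I_n.+1) :
  adj (comet n L) x y -> height L y <= (height L x).+1.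
Proof. by rewrite adj_parent; height_lia. Qed.

Lemma height_inj (n L : nat) (x y : 'I_n.+1) :
  height L x = height L y -> 0 < height L x -> x = y.
Proof. by move=> eq_h x_gt0; apply: val_inj; move: eq_h x_gt0; height_lia. Qed.

Lemma height_surj (n L k : nat) :
  L <= n -> k <= L -> {x : 'I_n.+1 | height L x = k.+1}.
Proof. by move=> le_Ln le_kL; exists (inord k); rewrite /height inordK; height_lia. Qed.

Lemma comet_up (n L : nat) (x : 'I_n.+1) :
  1 < height L x -> {y : 'I_n.+1 | adj (comet n L) x y & height L x = (height L y).+1}.
Proof.
move=> x_gt1; exists (inord x.-1).
  rewrite adj_parent /comet_parent inordK; last by have := ltn_ord x; lia.
  by move: x_gt1; height_lia.
rewrite /height inordK; last by have := ltn_ord x; lia.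
by move: x_gt1; height_lia.
Qed.

Lemma comet_leaf_adj (n L : nat) (x y : 'I_n.+1) :
  height L x = 0 -> height L y = 1 -> adj (comet n L) x y.
Proof. by rewrite adj_parent; height_lia. Qed.

Lemma card_leaves (n L : nat) : n - L <= #|leaves n L|.
Proof.
have := cardsC (leaves n L); rewrite card_ord.
suff: #|~: leaves n L| <= L.+1 by lia.
apply: leq_trans (subset_leq_card (_ : _ \subset [set inord i | i : 'I_L.+1])) _.
  apply/fintype.subsetP => x; rewrite !inE => hx.
  have lt_xL : x < L.+1 by move: hx; height_lia.
  by apply/imsetP; exists (Ordinal lt_xL); rewrite ?inE //= inord_val.
by apply: leq_trans (leq_imset_card _ _) _; rewrite card_ord.
Qed.

Lemma comet_dist_down (n L : nat) (x y : 'I_n.+1) :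
  0 < height L x -> height L y <= height L x ->
  tree_dist (comet n L) x y <= height L x - height L y.
Proof.
move=> x_gt0 le_yx.
suff [p xp [<- <-]] : exists2 p, path (adj (comet n L)) x p &
    last x p = y /\ size p = height L x - height L y.
  exact: tree_dist_path (comet_tree n L) xp.
have [k def_k] : exists k, height L x = height L y + k.
  by exists (height L x - height L y); lia.
rewrite def_k addKn; elim: k x x_gt0 def_k {le_yx} => [|k IHk] x x_gt0 def_k.
  exists [::] => //; split=> //=.
  by apply: (height_inj (L := L)); rewrite // def_k addn0.
have [x_gt1 | x_le1] := ltnP 1 (height L x).
  have [z xz def_z] := comet_up x_gt1.
  have [||p zp [p_y p_k]] := IHk z; try lia.
  by exists (z :: p); rewrite /= ?xz ?zp ?p_k.
have [k0 y0] : k = 0 /\ height L y = 0 by lia.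
exists [:: y]; rewrite /= ?k0 ?andbT //.
by rewrite adj_sym; apply: comet_leaf_adj => //; lia.
Qed.

Lemma comet_dist_up (n L : nat) (x y : 'I_n.+1) :
  0 < height L x -> height L x <= height L y ->
  tree_dist (comet n L) x y <= height L y - height L x.
Proof.
move=> x_gt0 le_xy.
suff [p xp [<- <-]] : exists2 p, path (adj (comet n L)) x p &
    last x p = y /\ size p = height L y - height L x.
  exact: tree_dist_path (comet_tree n L) xp.
have [k def_k] : exists k, height L y = height L x + k.
  by exists (height L y - height L x); lia.
rewrite def_k addKn; elim: k y def_k {le_xy} => [|k IHk] y def_k.
  exists [::] => //; split=> //=.
  by apply: (height_inj (L := L)); rewrite // def_k addn0.
have y_gt1 : 1 < height L y by rewrite def_k addnS ltnS ltn_addr.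
have [z yz def_z] := comet_up y_gt1.
have [|p xp [p_z p_k]] := IHk z; first lia.
exists (rcons p y); first by rewrite rcons_path xp p_z adj_sym.
by rewrite last_rcons size_rcons p_k.
Qed.

(** The vertex of height L/2 + 1 has eccentricity at most L/2 + 1, while that of
    c is at least the distance from c to a leaf. *)
Lemma comet_center_height (n L : nat) (c : 'I_n.+1) :
  L < n -> c \in Defs.center (comet n L) -> height L c <= L./2.+1.
Proof.
move=> lt_Ln /centerP c_min.
have [||x hx] := @height_surj n L L./2; try lia.
have x_gt0 : 0 < height L x by rewrite hx.
have h_le (y : 'I_n.+1) : height L y <= L.+1 by height_lia.
apply: (@leq_trans (tree_dist (comet n L) c (ord_max))).
  have leaf0 : height L (ord_max : 'I_n.+1) = 0 by height_lia.
  (* distances are bounded below by increments, so the height is reversed *)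
  have lip a b : adj (comet n L) a b -> L.+1 - height L b <= (L.+1 - height L a).+1.
    by rewrite adj_sym => /height_lip; lia.
  have := height_le_dist (h := fun z : 'I_n.+1 => L.+1 - height L z) c ord_max
    lip (comet_tree n L).
  rewrite leaf0 subn0; have := h_le c; move: (tree_dist _ _ _) (height L c) => d k; lia.
apply: leq_trans (tree_dist_le_ecc _ _ _) (leq_trans (c_min x) _).
apply/bigmax_leqP => y _; have := h_le y.
case: (leqP (height L x) (height L y)) => [le_xy | lt_yx] le_y.
  by apply: leq_trans (comet_dist_up x_gt0 le_xy) _; rewrite hx; lia.
by apply: leq_trans (comet_dist_down x_gt0 (ltnW lt_yx)) _; rewrite hx; lia.
Qed.

(** * Counting subtrees of comets *)

(** A subtree that reaches from v to the tip t of the spine passes through w and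
    u; the final segment that starts at w contains w and u but not v. *)
Lemma comet_subtree_mono (n L : nat) (v w u t : 'I_n.+1) :
  height L v < height L w <= height L u -> height L t = L.+1 ->
  num_subtrees (comet n L) v t < num_subtrees (comet n L) w u.
Proof.
move=> /andP[lt_vw le_wu] ht.
have h_le (y : 'I_n.+1) : height L y <= L.+1 by height_lia.
apply: proper_card; apply/properP; split.
  apply/fintype.subsetP => S; rewrite !inE => /and3P[subS vS tS].
  have in_S (z : 'I_n.+1) : height L v < height L z -> z \in S.1.
    move=> lt_vz.
    have [|y yS eq_h] := @subtree_height_ivt _ _ (height L) S v t (height L z)
      (@height_lip n L) subS vS tS.
      by rewrite ht h_le ltnW.
    by rewrite -(height_inj eq_h) //; lia.
  by rewrite subS !in_S //; lia.
pose W := [set x : 'I_n.+1 | height L w <= height L x].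
exists (W, induced_edges (comet n L) W); last first.
  by rewrite !inE /= (leqNgt _ (height L v)) lt_vw /= andbF.
rewrite !inE /= leqnn le_wu !andbT; apply: induced_subtree.
apply: (@rooted_connected _ W _ w (height L)); first by rewrite inE.
move=> x; rewrite inE => le_wx neq_xw.
have lt_wx : height L w < height L x.
  rewrite ltn_neqAle le_wx andbT; apply: contraNneq neq_xw => eq_h.
  by rewrite (height_inj eq_h) //; lia.
have x_gt1 : 1 < height L x by lia.
have [y xy hy] := comet_up x_gt1.
by exists y; rewrite adj_induced xy !inE; split; lia.
Qed.

(** A subtree through the tip t that contains the vertex 0 contains the whole
    spine, so it is given by its leaves; any other one is the final segment of
    the spine that starts at its lowest vertex. *)
Lemma comet_subtree_le (n L : nat) (v t : 'I_n.+1) :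
  height L t = L.+1 ->
  num_subtrees (comet n L) v t <= 2 ^ #|leaves n L| + n.+1.
Proof.
move=> ht; have treeE := comet_tree n L.
have h_le (y : 'I_n.+1) : height L y <= L.+1 by height_lia.
pose X := [set S : {set 'I_n.+1} * {set {set 'I_n.+1}} |
      [&& is_subtree (comet n L) S, v \in S.1 & t \in S.1]].
have inj_X : {in X &, injective fst}.
  move=> [W1 F1] [W2 F2]; rewrite !inE => /andP[S1 _] /andP[S2 _] /= eq_W.
  have := subtree_edges treeE S1; have := subtree_edges treeE S2.
  by rewrite /= eq_W => -> ->.
pose B := [set [set x | 0 < height L x] :|: Y | Y in powerset (leaves n L)].
pose C := [set [set x : 'I_n.+1 | height L a <= height L x] | a : 'I_n.+1].
rewrite /num_subtrees -/X -(card_in_imset inj_X).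
apply: (@leq_trans #|B :|: C|); last first.
  apply: leq_trans (leq_card_setU _ _) (leq_add _ _).
    by rewrite -card_powerset leq_imset_card.
  by apply: leq_trans (leq_imset_card _ _) _; rewrite card_ord.
apply/subset_leq_card/fintype.subsetP => _ /imsetP[S + ->].
rewrite inE => /and3P[subS _ tS].
have above a z : a \in S.1 -> 0 < height L z -> height L a <= height L z -> z \in S.1.
  move=> aS z_gt0 le_az.
  have [|y yS eq_h] := @subtree_height_ivt _ _ (height L) S a t (height L z)
      (@height_lip n L) subS aS tS.
    by rewrite ht h_le le_az.
  by rewrite -(height_inj eq_h) // eq_h.
have h0 : height L (ord0 : 'I_n.+1) = 1 by [].
rewrite inE; apply/orP; have [S0|S0] := boolP (ord0 \in S.1); [left|right].
  apply/imsetP; exists (S.1 :&: leaves n L).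
    by rewrite powersetE finset.subsetIr.
  apply/setP => x; rewrite !inE; case: posnP => [_|x_gt0] /=; first by rewrite andbT.
  by rewrite (above ord0) // h0.
apply/imsetP; exists [arg min_(a < t in S.1) height L a] => //.
case: arg_minnP => // a aS a_min.
apply/setP => x; rewrite inE; apply/idP/idP => [/a_min //|le_ax].
case: (posnP (height L x)) => [x0|x_gt0]; last exact: above le_ax.
by case/negP: S0; apply: (above a) => //; rewrite h0; lia.
Qed.

(** The vertices w and u are joined by subtrees made of the leaf l, the spine up
    to 0, 1 or 2 steps beyond w, and any set of other leaves. If u is a leaf then
    it has to be l; otherwise u is on the part of the spine before w. *)
Lemma comet_subtree_ge (n L : nat) (w u l : 'I_n.+1) :
  L <= n -> height L u < height L w -> height L w + 2 <= L.+1 ->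
  height L l = 0 -> (height L u = 0 -> u = l) ->
  3 * 2 ^ #|leaves n L :\ l| <= num_subtrees (comet n L) w u.
Proof.
move=> le_Ln lt_uw w_le hl def_u.
pose W (i : nat) (Y : {set 'I_n.+1}) :=
  l |: (Y :|: [set x : 'I_n.+1 | 0 < height L x <= height L w + i]).
pose f (z : 'I_3 * {set 'I_n.+1}) :=
  (W z.1 z.2, induced_edges (comet n L) (W z.1 z.2)).
pose D := finset.setX [set: 'I_3] (powerset (leaves n L :\ l)).
have leafP (Y : {set 'I_n.+1}) x : Y \in powerset (leaves n L :\ l) -> x \in Y ->
    height L x = 0.
  by rewrite powersetE => /fintype.subsetP sub /sub; rewrite !inE => /andP[_ /eqP].
have -> : 3 * 2 ^ #|leaves n L :\ l| = #|D|.
  by rewrite cardsX cardsT card_ord card_powerset.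
have f_inj : {in D &, injective f}.
  move=> [i Y] [j Z]; rewrite !inE /= => Yl Zl [eq_W _].
  (* the end of the spine part, hence i, can be read off from W *)
  have spine_in (k k' : 'I_3) (Y' : {set 'I_n.+1}) (x : 'I_n.+1) :
      Y' \subset leaves n L :\ l -> height L x = height L w + k' ->
      (x \in W k Y') = (k' <= k).
    move=> Y'l hx; rewrite !inE hx leq_add2l.
    have -> : (x == l) = false by apply/eqP => eq_xl; move: hx; rewrite eq_xl hl; lia.
    have -> : (x \in Y') = false.
      by apply/negP => /(leafP Y'); rewrite powersetE => /(_ Y'l); rewrite hx; lia.
    by rewrite /=; lia.
  have eq_k (k : 'I_3) : (k <= i) = (k <= j).
    have [||x hx] := @height_surj n L (height L w + k).-1 => //.
      by have := ltn_ord k; lia.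
    have hx' : height L x = height L w + k by lia.
    by rewrite -(spine_in i k Y x) // -(spine_in j k Z x) // eq_W.
  have eq_ij : i = j.
    by apply: val_inj; have := eq_k i; have := eq_k j; rewrite /= !leqnn; lia.
  congr (_, _) => //; apply/setP => x.
  have := congr1 (fun A : {set 'I_n.+1} => x \in A) eq_W; rewrite /= !inE eq_ij.
  have [-> _|neq_xl] /= := eqVneq x l.
    have notl (Y' : {set 'I_n.+1}) : Y' \subset leaves n L :\ l -> l \in Y' = false.
      by move=> /fintype.subsetP sub; apply/negP => /sub; rewrite !inE eqxx.
    by rewrite !notl.
  case: (posnP (height L x)) => [_|x_gt0]; first by rewrite !orbF.
  have notx (Y' : {set 'I_n.+1}) : Y' \subset leaves n L :\ l -> x \in Y' = false.
    by move=> Y'l; apply/negP => /(leafP Y'); rewrite powersetE => /(_ Y'l); lia.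
  by rewrite !notx.
rewrite -(card_in_imset f_inj).
apply/subset_leq_card/fintype.subsetP => _ /imsetP[[i Y] + ->].
rewrite !inE /= => Yl.
have h0 : height L (ord0 : 'I_n.+1) = 1 by [].
have W0 : ord0 \in W i Y by rewrite !inE h0; apply/orP; right; apply/orP; right; lia.
apply/and3P; split.
- apply/induced_subtree/(@rooted_connected _ _ _ ord0 (@nat_of_ord _)) => // x xW neq_x0.
  have [x_gt1|x_le1] := ltnP 1 (height L x).
    have [y xy hy] := comet_up x_gt1.
    have yW : y \in W i Y.
      move: xW; rewrite !inE => /or3P[/eqP eq_xl|/(leafP Y)|].
        by rewrite eq_xl hl in x_gt1.
        by rewrite powersetE => /(_ Yl); lia.
      by move=> /= hx; apply/orP; right; apply/orP; right; lia.
    exists y; rewrite adj_induced xy xW yW; split=> //.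
    by move: hy x_gt1; height_lia.
  have x0 : height L x = 0.
    apply/eqP; move: x_le1; rewrite leq_eqVlt ltnS leqn0 => /orP[/eqP h1|//].
    by case/eqP: neq_x0; apply: (@height_inj n L); rewrite h1.
  exists ord0; rewrite adj_induced xW W0 !andbT; split=> //.
    exact: (@comet_leaf_adj n L).
  by rewrite lt0n.
- by apply/orP; right; apply/orP; right; lia.
have [/def_u->|u_gt0] := posnP (height L u); first by rewrite eqxx.
by apply/orP; right; apply/orP; right; lia.
Qed.

(** * The core center of a comet *)

(** With w at height L - 1, all vertices v below w have a smaller eccentric
    subtree number than w: the term at the tip t of the minimum for v is already
    smaller than all terms of the minimum for w. *)
Lemma comet_core_height (n L : nat) (v : 'I_n.+1) :
  2 <= L < n -> n.+1 < 2 ^ (n - L).-1 ->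
  v \in core_center (comet n L) -> L.-1 <= height L v.
Proof.
move=> /andP[L_ge2 lt_Ln] n_small; rewrite inE => /forallP v_max.
have [||w hw] := @height_surj n L (L - 2); try lia.
have [||t ht] := @height_surj n L L; try lia.
rewrite leqNgt; apply/negP => lt_v.
have : ecc_subtree_num (comet n L) v < ecc_subtree_num (comet n L) w; last first.
  by rewrite ltnNge v_max.
apply: (@leq_ltn_trans (num_subtrees (comet n L) v t)); first exact: bigminn_le.
suff lt_f u : num_subtrees (comet n L) v t < num_subtrees (comet n L) w u.
  by apply: le_bigminn.
have [le_wu|lt_uw] := leqP (height L w) (height L u).
  by apply: comet_subtree_mono => //; rewrite hw; lia.
have [l hl def_u] : exists2 l : 'I_n.+1, height L l = 0 & height L u = 0 -> u = l.
  have [u0|u_gt0] := posnP (height L u); first by exists u.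
  by exists ord_max; [height_lia | lia].
(* 2^m + (n + 1) < 3 * 2^(m-1), where m is the number of leaves *)
have le_l : #|leaves n L| = #|leaves n L :\ l|.+1.
  by rewrite (cardsD1 l) inE hl eqxx.
apply: leq_trans (comet_subtree_ge _ lt_uw _ hl def_u); try lia.
apply: leq_ltn_trans (comet_subtree_le v ht) _.
rewrite le_l expnS mulSn addnC ltn_add2r.
apply: leq_trans n_small _; rewrite leq_exp2l //.
by have := card_leaves n L; lia.
Qed.

Lemma max_center_core_dist_ge (n L : nat) :
  2 <= L < n -> n.+1 < 2 ^ (n - L).-1 ->
  L <= 2 * max_center_core_dist n.+1 + 5.
Proof.
move=> L_bnd n_small; have treeE := comet_tree n L.
suff : L.-1 - L./2.+1 <= max_center_core_dist n.+1 by lia.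
apply: leq_trans (_ : center_core_dist (comet n L) <= _); last first.
  by apply: leq_bigmax_cond; apply/asboolP.
apply: le_bigminn => [|c c_cen]; first by rewrite card_ord; lia.
apply: le_bigminn => [|v v_core]; first by rewrite card_ord; lia.
have := height_le_dist c v (@height_lip n L) treeE.
have := comet_center_height _ c_cen; have := comet_core_height L_bnd n_small v_core.
lia.
Qed.

(** * The limit *)

Lemma quadratic_le_exp2 (q : nat) : 8 <= q -> q * q.+1 <= 2 ^ q.-1.
Proof.
elim: q => // q IHq; rewrite leq_eqVlt => /predU1P[<- //|lt_q].
have := IHq lt_q; case: q lt_q {IHq} => // q lt_q /= le_q; rewrite expnS; nia.
Qed.

(** The comet with about n/k leaves loses only a fraction 1/k of its vertices to
    the leaves, and yet 2^(n/k - 1) exceeds n. *)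
Lemma max_center_core_dist_asymp (k n : nat) :
  2 <= k -> k * (k + 8) <= n -> k * n <= 2 * k * max_center_core_dist n + 2 * n.
Proof.
move=> k_ge2; case: n => [|n]; first by rewrite muln0.
move=> n_ge; set m := n.+1 %/ k.
have m_ge : k + 8 <= m by rewrite leq_divRL 1?mulnC //; lia.
have def_n : k * m <= n.+1 by rewrite mulnC leq_divM.
have lt_n : n.+1 < k * m.+1 by rewrite mulnC ltn_ceil //; lia.
have m_le : 2 * m <= n.+1 by nia.
have := @max_center_core_dist_ge n (n - m); rewrite subKn; last by lia.
have L_bnd : 2 <= n - m < n by lia.
have n_small : n.+1 < 2 ^ m.-1.
  have : m * m.+1 <= 2 ^ m.-1 by apply: quadratic_le_exp2; lia.
  by nia.
move=> /(_ L_bnd n_small) le_L.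
have : n.+1 <= 2 * max_center_core_dist n.+1 + m + 6 by lia.
by nia.
Qed.

Unset Implicit Arguments.
Local Open Scope classical_set_scope.
Local Open Scope ring_scope.

Theorem proposition5p20 (R : realType) :
  (fun n : nat => (max_center_core_dist n)%:R / n%:R : R) @ \oo --> (1 / 2 : R).
Proof.
apply/cvgrPdist_le => e e_gt0.
pose k := (Num.truncn e^-1).+2.
have k_gt : 1 < e * k%:R.
  rewrite -ltr_pdivrMl // mulr1 (lt_le_trans (truncnS_gt _)) // ler_nat.
  exact: leqnSn.
exists (k * (k + 8))%N => // n /= n_ge.
have n_gt0 : 0 < n%:R :> R by rewrite ltr0n (leq_trans _ n_ge).
have k_gt0 : 0 < k%:R :> R by rewrite ltr0n.
have upper : 2 * (max_center_core_dist n)%:R <= n%:R :> R.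
  by rewrite -natrM ler_nat max_center_core_dist_le.
have lower : k%:R * n%:R <= 2 * k%:R * (max_center_core_dist n)%:R + 2 * n%:R :> R.
  by rewrite -!natrM -natrD ler_nat max_center_core_dist_asymp.
have le_half : (max_center_core_dist n)%:R / n%:R <= 1 / 2 :> R.
  by rewrite ler_pdivrMr //; lra.
rewrite ger0_norm ?subr_ge0 // lerBlDl -lerBlDr ler_pdivlMr //.
rewrite -(ler_pM2l k_gt0).
have : n%:R <= (e * k%:R) * n%:R by rewrite ler_peMl ?ltW.
lra.
Qed.
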